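(* Let $\mathbf{A}$ be an idempotent algebra and let $\mathbf{R}\le\mathbf{A}^2$ contain a directed walk of length $n-1$ (i.e. $a_1,\dots,a_n\in A$ with $(a_i,a_{i+1})\in R$ for $1\le i<n$). If $R$ locally $n$-absorbs the equality relation $=_A=\{(a,a):a\in A\}$ and $R^{\circ l}$ locally $n$-absorbs $R^{-1}$ for some $l\in\mathbb{N}$, then $R$ contains a loop, i.e. a pair $(a,a)$.
   Context: $R^{-1}=\{(b,a):(a,b)\in R\}$ and $R^{\circ l}$ is the $l$-fold relational composition $R\circ\dots\circ R$. Operations of $\mathbf{A}$ are applied coordinatewise. A tuple $(u_1,\dots,u_n)$ is a one-$S$-in-$R$ tuple if for exactly one $i$ we have $u_i\in S$ and all other $u_i$ are in $R$. For a relation $T\subseteq A^2$ which is a subuniverse of $\mathbf{A}^2$ and $S\subseteq A^2$, $T$ locally $n$-absorbs $S$ if for every finite set $\mathcal{C}$ of one-$S$-in-$T$ tuples of length $n$ there is an $n$-ary term operation $t$ of $\mathbf{A}$ with $t(u_1,\dots,u_n)\in T$ for all $(u_1,\dots,u_n)\in\mathcal{C}$. An algebra is idempotent if every basic operation $f$ satisfies $f(a,\dots,a)=a$. *)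

(* Defs.v *)
From mathcomp Require Import all_boot.
From mathcomp Require Import boolp classical_sets functions cardinality.

Set Implicit Arguments.
Unset Strict Implicit.
Unset Printing Implicit Defensive.

Local Open Scope classical_set_scope.

(* The signature is arbitrary (any type of operation symbols, of finite
   arities, 0 allowed) and so is the carrier. *)
Record algebra := Algebra {
  carrier :> Type;
  symbol : Type;
  arity : symbol -> nat;
  op : forall f : symbol, ('I_(arity f) -> carrier) -> carrier }.

Definition idempotent_algebra (A : algebra) : Prop :=
  forall (f : symbol A) (a : A), op (fun _ : 'I_(arity f) => a) = a.

Inductive term (A : algebra) (n : nat) : Type :=
| Var : 'I_n -> term A n
| App : forall f : symbol A, ('I_(arity f) -> term A n) -> term A n.

Fixpoint term_op (A : algebra) (n : nat) (t : term A n) (x : 'I_n -> A) : A :=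
  match t with
  | Var i => x i
  | App f s => op (fun i : 'I_(arity f) => term_op (s i) x)
  end.

Definition coordwise (X : Type) (n : nat) (g : ('I_n -> X) -> X)
    (u : 'I_n -> X * X) : X * X :=
  (g (fun i => (u i).1), g (fun i => (u i).2)).

Definition square (A : algebra) : algebra :=
  @Algebra (A * A)%type (symbol A) (@arity A)
    (fun f u => coordwise (@op A f) u).

Definition subuniverse (A : algebra) (S : set A) : Prop :=
  forall (f : symbol A) (u : 'I_(arity f) -> A),
    (forall i, S (u i)) -> S (op u).

(* relpow R 0 is the equality relation. *)
Definition relpow (X : Type) (R : set (X * X)) (l : nat) : set (X * X) :=
  iter l (fun S => (S \; R)%relation) diagonal.

(* Uniqueness bears on the whole condition: a tuple in which u i is in S,
   every other u j is in T, and some other u j happens to lie in S as well is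
   still a one-S-in-T tuple, unless u i is also in T.  In that last case all
   entries are in T, so that every term operation maps the tuple into T when T
   is a subuniverse, and the absorption condition below is automatic for it. *)
Definition one_in (X : Type) (n : nat) (S T : set X) (u : 'I_n -> X) : Prop :=
  exists! i : 'I_n, S (u i) /\ (forall j : 'I_n, j <> i -> T (u j)).

Definition locally_absorbs (A : algebra) (n : nat) (T S : set (A * A)) : Prop :=
  forall C : set ('I_n -> A * A),
    finite_set C -> C `<=` one_in S T ->
    exists t : term A n,
      forall u, C u -> T (coordwise (@term_op A n t) u).

(* a_1, ..., a_n is indexed from 0. *)
Definition directed_walk (X : Type) (n : nat) (R : set (X * X))
    (a : 'I_n -> X) : Prop :=
  forall i j : 'I_n, j = i.+1 :> nat -> R (a i, a j).

(* Main.v *)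
(* If R contains a triangle p_0, p_1, p_2 (edges in both directions), it has a
   loop: let t be the n-ary term absorbing equality on {p_0, p_1, p_2}, and let
   f be a 3-colouring of the words of length m over n letters such that w and
   its shift w'c get the same colour only if c is the last letter of w.
   Evaluating the m-fold iterate of t at p o f gives an element that, by
   idempotence, is also the value of the (m+1)-fold iterate at f(w) and at
   f(w'c); the innermost t only has to absorb one equality for each w.  Such a
   colouring comes from the parity of the distance to the next event of a kind
   that never occurs twice in a row.

   A walk of length at least n-1 can be lengthened by one step: let coordinate j
   of t pause at time j.  So a symmetric R with an edge has a closed walk of odd
   length; if R has one of length g > 1, then its (g-2)-nd power contains a
   triangle, hence a loop, and g can be lowered by 2 down to 1.  A closed walk
   of length 2^(j+1) gives a 2-cycle in the 2^j-th power, whose symmetric part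
   thus has a loop, so any R with a closed walk of positive length has a loop.
   The absorption of R^-1 is used only to produce the first closed walk. *)

Require Import Defs.
From mathcomp Require Import all_boot.
From mathcomp Require Import boolp classical_sets functions cardinality.
From mathcomp Require Import zify.

Set Implicit Arguments.
Unset Strict Implicit.
Unset Printing Implicit Defensive.

(** * Powers of a relation and walks *)

Lemma relpow_add (X : Type) (R : set (X * X)) j k a c :
  relpow R (j + k) (a, c) <-> exists2 b, relpow R j (a, b) & relpow R k (b, c).
Proof.
elim: j a => [|j IHj] a.
  by split=> [Rac|[b /diagonalP <- //]]; exists a.
split=> [[d Rad /IHj [b Rdb Rbc]]|[b [d Rad Rdb] Rbc]].
  by exists b => //; exists d.
by exists d => //; apply/IHj; exists b.
Qed.

Lemma relpow1 (X : Type) (R : set (X * X)) a b : relpow R 1 (a, b) <-> R (a, b).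
Proof.
by split=> [[c /= Rac cb]|Rab]; [rewrite -(_ : c = b)|exists b].
Qed.

Lemma relpowS (X : Type) (R : set (X * X)) k a c :
  relpow R k.+1 (a, c) <-> exists2 b, relpow R k (a, b) & R (b, c).
Proof.
by rewrite -addn1 relpow_add; split=> -[b ? /relpow1 ?]; exists b.
Qed.

Lemma relpow_walk (X : Type) (R : set (X * X)) k a b :
  relpow R k (a, b) <->
  exists w : nat -> X,
    [/\ w 0 = a, w k = b & forall s, s < k -> R (w s, w s.+1)].
Proof.
elim: k b => [|k IHk] b.
  by split=> [/diagonalP ->|[w [<- <- _]] //]; exists (fun=> b).
rewrite relpowS; split=> [[c /IHk [w [w0 wk wR]] Rcb]|[w [w0 wk wR]]].
  exists (fun s => if s <= k then w s else b); split=> [||s ltsk] //.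
    by rewrite ltnn.
  have le_sk : s <= k by [].
  rewrite le_sk; case: ltnP => [lt_sk|le_ks]; first exact: wR.
  have /eqP -> : s == k by rewrite eqn_leq le_sk.
  by rewrite wk.
exists (w k); last by rewrite -wk; apply: wR.
by apply/IHk; exists w; split=> // s ltsk; apply: wR; lia.
Qed.

Lemma relpow_mul (X : Type) (R : set (X * X)) j k a b :
  relpow (relpow R j) k (a, b) <-> relpow R (j * k) (a, b).
Proof.
elim: k b => [|k IHk] b; first by rewrite muln0.
rewrite relpowS mulnSr relpow_add.
by split=> -[c /IHk ? ?]; exists c.
Qed.

Lemma relpow_sym (X : Type) (R : set (X * X)) k a b :
  (forall x y, R (x, y) -> R (y, x)) -> relpow R k (a, b) -> relpow R k (b, a).
Proof.
move=> symR; elim: k b => [|k IHk] b; first by move=> /diagonalP ->.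
case/relpowS => c /IHk Rca /symR Rbc.
by exists c.
Qed.

Lemma relpow_odd (X : Type) (R : set (X * X)) k a b :
  (forall x y, R (x, y) -> R (y, x)) -> R (a, b) -> relpow R k.*2.+1 (a, b).
Proof.
move=> symR Rab; elim: k => [|k IHk]; first exact/relpow1.
rewrite doubleS; apply/relpowS; exists a => //; apply/relpowS.
by exists b => //; apply: symR.
Qed.

Lemma relpow_even (X : Type) (R : set (X * X)) k a b :
  (forall x y, R (x, y) -> R (y, x)) -> R (a, b) -> relpow R k.*2 (a, a).
Proof.
move=> symR Rab; elim: k => [//|k IHk].
by apply/relpowS; exists b; [apply/relpowS; exists a|apply: symR].
Qed.

Lemma relpow_inv (X : Type) (R : set (X * X)) k a b :
  relpow R k (b, a) -> relpow (R^-1)%relation k (a, b).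
Proof.
elim: k b => [|k IHk] b; first by move=> /diagonalP ->.
case=> c Rbc /IHk Rac.
by apply/relpowS; exists c.
Qed.

Lemma relpow_diag (X : Type) k (a : X) : relpow (@diagonal X) k (a, a).
Proof. by elim: k => [//|k IHk]; apply/relpowS; exists a. Qed.

(** * Term operations and absorption *)

Lemma term_op_idem (A : algebra) (hA : idempotent_algebra A) n (t : term A n) a :
  term_op t (fun=> a) = a.
Proof.
elim: t => [//|f s IHs] /=; rewrite -[RHS](hA f a); congr op.
by apply/funext => i; apply: IHs.
Qed.

Lemma term_op_compat (A : algebra) (T : set (A * A))
    (hT : subuniverse (A := square A) T) n (t : term A n) (x y : 'I_n -> A) :
  (forall i, T (x i, y i)) -> T (term_op t x, term_op t y).
Proof.
by move=> Txy; elim: t => [i|f s IHs] //=; apply: (hT f (fun i => (_, _))).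
Qed.

Lemma subuniverse_relpow (A : algebra) (T : set (A * A))
    (hT : subuniverse (A := square A) T) k :
  subuniverse (A := square A) (relpow T k).
Proof.
elim: k => [|k IHk] f u Tu; rewrite /= /coordwise.
  by rewrite /= /diagonal /=; congr op; apply/funext => i; apply: Tu.
have {}Tu i : exists b, T ((u i).1, b) /\ relpow T k (b, (u i).2).
  by case: (Tu i) => b; exists b.
case: (choice Tu) => b Tb; exists (@op A f b).
  by apply: (hT f (fun i => ((u i).1, b i))) => i; case: (Tb i).
by apply: (IHk f (fun i => (b i, (u i).2))) => i; case: (Tb i).
Qed.

(* Local absorption, with the finite sets of tuples replaced by all tuples with
   entries in a given finite family, and with the uniqueness of the S-entry
   dropped. *)
Definition absorbs (A : algebra) (n : nat) (T S : set (A * A)) : Prop :=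
  forall (K : finType) (v : K -> A), exists t : term A n,
    forall (x y : 'I_n -> K) (i : 'I_n),
      S (v (x i), v (y i)) -> (forall j, j <> i -> T (v (x j), v (y j))) ->
      T (term_op t (v \o x), term_op t (v \o y)).

Lemma locally_absorbs_absorbs (A : algebra) n (T S : set (A * A))
    (hT : subuniverse (A := square A) T) :
  locally_absorbs n T S -> absorbs n T S.
Proof.
move=> hTS K v.
pose tup (z : {ffun 'I_n -> K * K}) i := (v (z i).1, v (z i).2).
pose C := [set u | range tup u /\ one_in S T u]%classic.
have finC : finite_set C.
  apply: (@sub_finite_set _ _ (range tup)); first by move=> u [].
  exact/finite_image/finite_finset.
have [|t tC] := hTS C finC; first by move=> u [].
exists t => x y i Sxy Txy.
pose u j := (v (x j), v (y j)).
have [uniq_i|/existsNP [i']] :=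
    pselect (forall i', S (u i') /\ (forall j, j <> i' -> T (u j)) -> i = i').
  apply: (tC u); split; last by exists i.
  by exists [ffun j => (x j, y j)] => //; apply/funext => j; rewrite /tup ffunE.
case/not_implyP => -[Su Tu] neq_ii'.
apply: term_op_compat => // j; case: (eqVneq j i) => [->|/eqP]; last exact: Txy.
exact: Tu.
Qed.

Lemma absorbs_relpow (A : algebra) n (T S : set (A * A)) k :
  absorbs n T S -> absorbs n (relpow T k) (relpow S k).
Proof.
move=> hTS K v.
(* Walks are fixed for all pairs at once, so that [t] can be chosen for the finite set of their
   vertices; a constant stands in where no walk exists. *)
have walkE (R : set (A * A)) (p : K * K) : exists w : nat -> A,
    relpow R k (v p.1, v p.2) ->
    [/\ w 0 = v p.1, w k = v p.2 & forall s, s < k -> R (w s, w s.+1)].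
  have [/relpow_walk [w Hw]|nR] := pselect (relpow R k (v p.1, v p.2)).
    by exists w.
  by exists (fun=> v p.1).
have [wT HT] := choice (walkE T); have [wS HS] := choice (walkE S).
pose v' (q : bool * (K * K) * 'I_k.+1) :=
  if q.1.1 then wS q.1.2 q.2 else wT q.1.2 q.2.
have [t tP] := hTS _ v'; exists t => x y i Sxy Txy.
pose z s j : bool * (K * K) * 'I_k.+1 := (j == i, (x j, y j), inord s).
have zE s j : s <= k ->
    v' (z s j) = if j == i then wS (x j, y j) s else wT (x j, y j) s.
  by move=> le_sk; rewrite /v' /z /= inordK.
have [/= Si0 Sik SiR] := HS (x i, y i) Sxy.
have {}HT j (ji : j <> i) := HT (x j, y j) (Txy j ji).
apply/relpow_walk; exists (fun s => term_op t (v' \o z s)); split.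
- congr term_op; apply/funext => j /=; rewrite zE //.
  by case: eqP => [-> //|/HT []].
- congr term_op; apply/funext => j /=; rewrite zE //.
  by case: eqP => [-> //|/HT []].
- move=> s lt_sk; apply: (tP _ _ i) => [|j ji].
    by rewrite !zE ?eqxx //; [apply: SiR|apply: ltnW].
  have [_ _ TR] := HT j ji; move/eqP/negPf: (ji) => ji'.
  by rewrite !zE ?ji' //; [apply: TR|apply: ltnW].
Qed.

Lemma absorbs_diag_relpow (A : algebra) n (T : set (A * A)) k :
  absorbs n T diagonal -> absorbs n (relpow T k) diagonal.
Proof.
move=> hT K v; have [t tP] := absorbs_relpow k hT v.
exists t => x y i vxy; apply: (tP _ _ i).
by rewrite (_ : v (x i) = v (y i)) //; apply: relpow_diag.
Qed.

Lemma relpow_extend (A : algebra) (hA : idempotent_algebra A) n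
    (T : set (A * A)) (subT : subuniverse (A := square A) T)
    (hT : absorbs n T diagonal) k k' a b :
  n.-1 <= k -> k <= k' -> relpow T k (a, b) -> relpow T k' (a, b).
Proof.
move=> le_nk /subnKC <-; elim: (k' - k) => [|d IHd]; first by rewrite addn0.
rewrite addnS => /IHd; move: (k + d) (leq_trans le_nk (leq_addr d k)) => m le_nm.
case/relpow_walk => w [w0 wm wT]; have [t tP] := hT _ (fun s : 'I_m.+1 => w s).
(* Coordinate [j] is at [w j] at both times [j] and [j+1]; [n.-1 <= m] leaves room for all the
   pauses. *)
pose z s (j : 'I_n) : 'I_m.+1 := inord (if s <= j then s else s.-1).
have zE s j : s <= m.+1 -> z s j = (if s <= j then s else s.-1) :> nat.
  move=> le_sm; rewrite inordK //; have lt_jn := ltn_ord j.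
  by case: (leqP s j); lia.
apply/relpow_walk; exists (fun s => term_op t (fun j => w (z s j))); split.
- rewrite -[RHS](term_op_idem hA t); congr term_op; apply/funext => j.
  by rewrite zE.
- rewrite -[RHS](term_op_idem hA t); congr term_op; apply/funext => j.
  by rewrite zE // ifN //; move: (ltn_ord j); lia.
- move=> s lt_sm; case: (ltnP s n) => [lt_sn|le_ns]; last first.
    apply: term_op_compat => // j; rewrite !zE //; last exact: ltnW.
    have lt_js := leq_trans (ltn_ord j) le_ns.
    rewrite (ltn_geF lt_js) (ltn_geF (leqW lt_js)) /=.
    by have := wT s.-1; rewrite (ltn_predK lt_js); apply.
  have le_sm : s <= m.+1 := ltnW lt_sm.
  apply: (tP _ _ (Ordinal lt_sn)) => [|j /eqP].
    by rewrite !zE //= leqnn ltnn.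
  rewrite -val_eqE /= => neq_js; rewrite !zE //.
  case: (ltngtP s j) neq_js => [lt_sj _|lt_js _|-> /eqP //].
    by apply: wT; apply: leq_trans lt_sj _; move: (ltn_ord j); clear -le_nm; lia.
  by have := wT s.-1; rewrite (ltn_predK lt_js); apply.
Qed.

(** * A 3-colouring of sequences *)

Definition shift (I : Type) (x : nat -> I) : nat -> I := fun k => x k.+1.

Definition scons (I : Type) (i : I) (x : nat -> I) : nat -> I :=
  fun k => if k is k'.+1 then x k' else i.

(* The end of a plateau, or a local maximum that does not follow a plateau:
   such events never occur at two consecutive positions, and a long stretch
   without events ends in a plateau. *)
Definition event (x : nat -> nat) : bool :=
  ((x 1 == x 2) && (x 2 != x 3)) ||
  [&& x 0 != x 1, x 1 < x 2 & x 3 < x 2].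

Fixpoint next_event (N : nat) (x : nat -> nat) : nat :=
  if N is N'.+1 then if event x then 0 else (next_event N' (shift x)).+1 else 0.

Lemma event_shift x : event x -> ~~ event (shift x).
Proof. rewrite /event /shift; lia. Qed.

(** Compares two caps, since a shift uses up one unit of the cap. *)
Lemma next_eventS N x :
  next_event N.+1 x = next_event N x \/
  next_event N x = N /\ forall k, k <= N -> ~~ event (iter k (@shift nat) x).
Proof.
elim: N x => [|N IHN] x.
  by rewrite /=; case: ifP => [|/negbT nex]; [left|right; split=> // -[]].
rewrite [next_event N.+2 x]/= -/(next_event N.+1 (shift x)) [next_event N.+1 x]/=.
case: ifP => [|/negbT nex]; first by left.
case: (IHN (shift x)) => [->|[-> nev]]; [by left|right; split=> // -[//|k]].
by rewrite ltnS iterSr; apply: nev.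
Qed.

Lemma next_event_ext N x y :
  (forall k, k < N + 3 -> x k = y k) -> next_event N x = next_event N y.
Proof.
elim: N x y => [//|N IHN] x y xy /=.
rewrite (IHN (shift x) (shift y)); last by move=> k ltk; apply: xy; lia.
by rewrite /event !xy; lia.
Qed.

Lemma iter_shiftE k (x : nat -> nat) j : iter k (@shift nat) x j = x (k + j).
Proof. by elim: k x j => [//|k IHk] x j; rewrite iterS /shift IHk addnS. Qed.

(** If the last two letters differ, then, no plateau ending, neighbours differ from position 1 on.
    Without local maxima, a rise in the middle goes on to the end and a fall there reaches back to
    position 2; both need more than [n] values. *)
Lemma eventless_plateau n (x : nat -> nat) : (forall k, x k < n) ->
  (forall k, k <= n.*2 -> ~~ event (iter k (@shift nat) x)) ->
  x (n.*2 + 2) = x (n.*2 + 3).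
Proof.
move=> ltxn nev; apply/eqP/contraT => neq_end.
have {}nev k : k <= n.*2 ->
    ~~ ((x k.+1 == x k.+2) && (x k.+2 != x k.+3)) /\
    ~~ [&& x k != x k.+1, x k.+1 < x k.+2 & x k.+3 < x k.+2].
  by move=> /nev; rewrite /event !iter_shiftE !addnS addn0 negb_or => /andP.
have neqx d : d <= n.*2.+1 -> x (n.*2.+1 - d).+1 != x (n.*2.+1 - d).+2.
  elim: d => [|d IHd] le_d; first by move: neq_end; rewrite subn0 addn2 addn3.
  have [|+ _] := nev (n.*2.+1 - d.+1); first lia.
  by rewrite (_ : (n.*2.+1 - d.+1).+1 = n.*2.+1 - d) 1?IHd; lia.
have {}neqx k : 0 < k <= n.*2.+2 -> x k != x k.+1.
  by move=> k_le; have := neqx (n.*2.+2 - k);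
    rewrite (_ : (n.*2.+1 - (n.*2.+2 - k)).+1 = k); [apply|]; lia.
have [lt_mid|le_mid] := ltnP (x n.+2) (x n.+3).
  have asc d : d <= n -> x (n.+2 + d) < x (n.+2 + d).+1.
    elim: d => [|d IHd] le_d; first by rewrite addn0.
    have := IHd (ltnW le_d); have [|_] := nev (n.+2 + d).-1; first lia.
    have := neqx (n.+2 + d).-1; have := neqx (n.+2 + d).+1.
    rewrite addnS prednK; lia.
  have big d : d <= n -> d <= x (n.+2 + d).
    by elim: d => [//|d IHd] le_d; have := asc d; have := IHd; rewrite addnS; lia.
  by have := big n (leqnn n); have := ltxn (n.+2 + n); lia.
have desc d : d <= n -> x (n.+2 - d).+1 < x (n.+2 - d).
  elim: d => [|d IHd] le_d; first by have := neqx n.+2; rewrite subn0; lia.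
  have := IHd (ltnW le_d); have [|_] := nev (n - d); first lia.
  have := neqx (n - d); have := neqx (n - d).+1.
  rewrite (_ : n.+2 - d = (n - d).+2); last lia.
  rewrite (_ : n.+2 - d.+1 = (n - d).+1); last lia.
  have := neqx (n.+2 - d.+1); lia.
have big d : d <= n -> d <= x (n.+3 - d).
  elim: d => [//|d IHd] le_d; have := desc d; have := IHd.
  rewrite (_ : n.+3 - d = (n.+2 - d).+1); last lia.
  by rewrite subSS; lia.
by have := big n (leqnn n); have := ltxn (n.+3 - n); lia.
Qed.

(** Distance 0 has its own colour, as the distance after an event may have either parity. Positive
    distances change parity under a shift, unless the cap interferes. *)
Definition colour (N : nat) (x : nat -> nat) : 'I_3 :=
  inord (if next_event N x is d.+1 then ~~ odd d : nat else 2).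

Lemma colour_eq N x y : colour N x = colour N y ->
  (next_event N x == 0) = (next_event N y == 0) /\
  odd (next_event N x) = odd (next_event N y).
Proof.
rewrite /colour => /(congr1 val).
case: (next_event N x) (next_event N y) => [|d] [|d'] //=;
  by rewrite !inordK; do 2?case: odd.
Qed.

(** Equal colours exclude an event at the front and then force the shifted sequence to have no event
    up to the cap. *)
Lemma colour_shift n (x : nat -> nat) : (forall k, x k < n) ->
  colour n.*2 x = colour n.*2 (shift x) -> x (n.*2 + 2) = x (n.*2 + 3).
Proof.
move=> ltxn /colour_eq; have n_gt0 : 0 < n by apply: leq_ltn_trans (ltxn 0).
case: n n_gt0 ltxn => // n _ ltxn eq_col; apply: (eventless_plateau ltxn).
move: eq_col; rewrite doubleS; move: n.*2.+1 => N.
have [ex|nex] := boolP (event x).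
  have nesx := event_shift ex.
  by rewrite /= ex (negbTE nesx) /= => -[].
case: (next_eventS N (shift x)) => [->|[_ nev _]].
  by rewrite /= (negbTE nex) /= => -[_]; case: odd.
by case=> [//|k]; rewrite ltnS iterSr; apply: nev.
Qed.

(** * Iterated terms and the triangle *)

(** The outermost [t] reads the first letter; [d] only pads words to sequences. *)
Fixpoint iter_term (A : algebra) (n : nat) (t : term A n) (m : nat)
    (f : (nat -> 'I_n) -> A) (d : 'I_n) : A :=
  if m is m'.+1
  then term_op t (fun i => iter_term t m' (f \o scons i) d)
  else f (fun=> d).

Definition determined (I C : Type) (m : nat) (f : (nat -> I) -> C) : Prop :=
  forall x y, (forall k, k < m -> x k = y k) -> f x = f y.

Lemma determined_scons (I C : Type) m (f : (nat -> I) -> C) i :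
  determined m.+1 f -> determined m (f \o scons i).
Proof. by move=> det x y xy; apply: det => -[//|k] /xy. Qed.

(** The innermost [t] reads a letter that [f] ignores. *)
Lemma iter_term_determined (A : algebra) (hA : idempotent_algebra A) n
    (t : term A n) m (f : (nat -> 'I_n) -> A) d :
  determined m f -> iter_term t m.+1 f d = iter_term t m f d.
Proof.
elim: m f => [|m IHm] f det.
  rewrite -[RHS](term_op_idem hA t) /=; congr term_op; apply/funext => i.
  exact: det.
rewrite /=; congr term_op; apply/funext => i.
exact/IHm/determined_scons.
Qed.

(** The outermost [t] reads the letter that the shift drops. *)
Lemma iter_term_shift (A : algebra) (hA : idempotent_algebra A) n
    (t : term A n) m (f : (nat -> 'I_n) -> A) d :
  iter_term t m.+1 (f \o @shift 'I_n) d = iter_term t m f d.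
Proof. by rewrite -[RHS](term_op_idem hA t). Qed.

Lemma triangle_loop (A : algebra) (hA : idempotent_algebra A) n (d0 : 'I_n)
    (T : set (A * A)) (subT : subuniverse (A := square A) T)
    (hT : absorbs n T diagonal) (p : 'I_3 -> A) :
  (forall i j, i <> j -> T (p i, p j)) -> exists a, T (a, a).
Proof.
move=> Tp; have [t tP] := hT _ p.
(* After each prefix of length [m], at most one last letter makes [f] and [g] agree: the innermost
   [t] absorbs that equality, and the outer levels preserve [T]. *)
have edge m (f g : (nat -> 'I_n) -> 'I_3) :
    (forall x y, (forall k, k < m -> x k = y k) ->
       f x = g x -> f y = g y -> x m = y m) ->
    T (iter_term t m.+1 (p \o f) d0, iter_term t m.+1 (p \o g) d0).
  elim: m f g => [|m IHm] f g fg.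
    have [[i eqi]|neq] :=
        pselect (exists i, f (scons i (fun=> d0)) = g (scons i (fun=> d0))).
      apply: (tP _ _ i) => [|j neq_ji]; first by rewrite eqi.
      by apply: Tp => eqj; apply: neq_ji; apply: (fg _ _ _ eqj eqi).
    by apply: term_op_compat => // i; apply: Tp => eqi; apply: neq; exists i.
  apply: term_op_compat => // i; apply: (IHm (f \o scons i) (g \o scons i)).
  by move=> x y xy fx fy; apply: (fg _ _ _ fx fy) => -[//|k] /xy.
pose f (x : nat -> 'I_n) := colour n.*2 (fun k => x k).
have det : determined (n.*2 + 3) (p \o f).
  move=> x y xy; rewrite /= /f /colour.
  by rewrite (@next_event_ext _ _ (fun k => y k)) // => k /xy ->.
exists (iter_term t (n.*2 + 3) (p \o f) d0).
rewrite -{1}(iter_term_determined hA t d0 det) -(iter_term_shift hA t (n.*2 + 3)).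
apply: (edge _ f (f \o @shift 'I_n)) => x y xy fx fy.
(* The last letter repeats the one before it, so the prefix determines it. *)
have plateau (z : nat -> 'I_n) : f z = f (shift z) -> z (n.*2 + 3) = z (n.*2 + 2).
  by move=> /colour_shift -/(_ (fun k => ltn_ord (z k))) /esym /val_inj.
by rewrite !plateau // xy // ltn_add2l.
Qed.

(** * From closed walks to loops *)

Lemma edge_sym_loop (A : algebra) (hA : idempotent_algebra A) n (d0 : 'I_n)
    (Q : set (A * A)) (subQ : subuniverse (A := square A) Q)
    (hQ : absorbs n Q diagonal) a b :
  Q (a, b) -> Q (b, a) -> exists c, Q (c, c).
Proof.
move=> Qab Qba.
pose S := [set q : A * A | Q q /\ Q (q.2, q.1)]%classic.
have symS x y : S (x, y) -> S (y, x) by case.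
have subS : subuniverse (A := square A) S.
  move=> f u Su; split; first by apply: subQ => i; case: (Su i).
  by apply: (subQ f (fun i => ((u i).2, (u i).1))) => i; case: (Su i).
have hS : absorbs n S diagonal.
  move=> K v; have [t tP] := hQ K v; exists t => x y i vxy Sxy.
  split; first by apply: (tP _ _ i) => // j /Sxy [].
  by apply: (tP _ _ i) => [|j /Sxy [//]]; apply/esym/vxy.
suff [c []] : exists c, S (c, c) by exists c.
suff descent k c : relpow S k.*2.+1 (c, c) -> exists c, S (c, c).
  (* Going back and forth gives length [2n]; one pause makes it odd. *)
  apply: (descent n a); apply: (relpow_extend hA subS hS (k := n.*2)); [lia..|].
  exact: (relpow_even _ symS (b := b)).
elim: k c {a b Qab Qba} => [|k IHk] a; first by move/relpow1; exists a.
case/relpow_walk => w [w0 wk wS].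
(* The triangle is [w 0], [w 1], [w 2]: two edges are padded by going back and forth, and the rest
   of the closed walk, of length [2k+1], is the third side. *)
have T01 := relpow_odd k symS (wS 0 isT).
have T12 := relpow_odd k symS (wS 1 isT).
have T20 : relpow S k.*2.+1 (w 2, w 0).
  apply/relpow_walk; exists (fun s => w s.+2); split=> //; first by rewrite w0 -wk.
  by move=> s lt_s; apply: wS; rewrite doubleS.
have symT x y := @relpow_sym _ S k.*2.+1 x y symS.
have [|c] := triangle_loop hA d0 (subuniverse_relpow subS (k := k.*2.+1))
    (absorbs_diag_relpow k.*2.+1 hS) (p := fun i : 'I_3 => w i).
  by case=> [[|[|[|//]]] ?] [[|[|[|//]]] ?] neq;
    first [by case: neq; apply: val_inj | exact: T01 | exact: T12 | exact: T20
          | exact: (symT _ _ T01) | exact: (symT _ _ T12) | exact: (symT _ _ T20)].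
exact: IHk.
Qed.

(** Serves [l = 0]. Changing the coordinates of [t] from [b] to [a] one at a time, each change being
    absorbed into an equality, links the constants [b] and [a]. *)
Lemma absorbs_inv_diag_edge (A : algebra) (hA : idempotent_algebra A) n
    (R : set (A * A)) (hR : absorbs n diagonal (R^-1)%relation) a b :
  R (a, b) -> a = b.
Proof.
move=> Rab; have [t tP] := hR _ (fun c : bool => if c then a else b).
pose z s (j : 'I_n) := j < s.
have step s : s <= n ->
    b = term_op t ((fun c : bool => if c then a else b) \o z s).
  elim: s => [|s IHs] lt_sn; first by rewrite -[LHS](term_op_idem hA t).
  apply: (etrans (IHs (ltnW lt_sn))); apply: (tP _ _ (Ordinal lt_sn)) => [|j /eqP].
    by rewrite /z /= ltnn leqnn.
  by rewrite -val_eqE /z ltnS [j <= s]leq_eqVlt /= => /negbTE ->.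
rewrite (step n (leqnn n)) -[LHS](term_op_idem hA t); congr term_op.
by apply/funext => j; rewrite /= /z ltn_ord.
Qed.

(* All coordinates run cyclically through a walk from a to b of the n-th power
   of R^l and back to a along the n-step walk from a to b; they jump back one
   after the other. *)
Lemma closed_walk (A : algebra) n l (R : set (A * A))
    (hR : absorbs n.+1 (relpow R l) (R^-1)%relation) a b :
  relpow R n.+1 (a, b) -> relpow R (l * (n.+1 * n)) (a, b) ->
  exists c, relpow R (l * (n.+1 * n.+1)) (c, c).
Proof.
move=> Rba Rab; have {}Rba := relpow_inv Rba; have hP := absorbs_relpow n.+1 hR.
move: Rab; rewrite -relpow_mul -relpow_mul => /relpow_walk [p [p0 pn pP]].
have [t tP] := hP _ (fun s : 'I_n.+1 => p s).
pose r s j := if s <= j then s + (n - j) else s - j.+1.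
pose z s (j : 'I_n.+1) : 'I_n.+1 := inord (r s j).
have zE s j : s <= n.+1 -> z s j = r s j :> nat.
  by move=> le_sn; rewrite inordK // /r; case: (leqP s j); have := ltn_ord j; lia.
exists (term_op t (fun j => p (z 0 j))).
rewrite -relpow_mul -relpow_mul; apply/relpow_walk.
exists (fun s => term_op t (fun j => p (z s j))); split=> //.
  congr term_op; apply/funext => j; rewrite !zE // /r leq0n ifN.
    by rewrite subSS.
  by rewrite -ltnNge.
move=> s lt_sn; apply: (tP _ _ (Ordinal lt_sn)) => [|j /eqP].
  rewrite !zE //=; last exact: ltnW.
  by rewrite /r leqnn ltnn subnn subnKC // p0 pn.
rewrite -val_eqE /= => neq_js; rewrite !zE //; last exact: ltnW.
have lt_jn := ltn_ord j.
rewrite /r; case: (ltngtP s j) neq_js => [lt_sj _|lt_js _|-> /eqP //].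
  by rewrite addSn; apply: pP; lia.
by rewrite subSn //; apply: pP; lia.
Qed.

Theorem theorem31 (A : algebra) (hA : idempotent_algebra A)
    (R : set (A * A)) (hR : subuniverse (A := square A) R)
    (n : nat) (hn : 0 < n)
    (hwalk : exists a : 'I_n -> A, directed_walk R a)
    (heq : locally_absorbs n R diagonal)
    (l : nat)
    (hinv : locally_absorbs n (relpow R l) (R^-1)%relation) :
  exists a : A, R (a, a).
Proof.
have absR := locally_absorbs_absorbs hR heq.
have {hinv} := locally_absorbs_absorbs (subuniverse_relpow hR (k := l)) hinv.
case: n hn hwalk heq absR => [//|n] _ [w walk_w] _ absR absI.
have walk_ab : relpow R n (w ord0, w ord_max).
  apply/relpow_walk; exists (fun s => w (inord s)); split.
  - by congr w; apply: val_inj; rewrite /= inordK.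
  - by congr w; apply: val_inj; rewrite /= inordK.
  - by move=> s lt_sn; apply: walk_w; rewrite !inordK // ltnS ltnW.
have extend := relpow_extend hA hR absR.
case: l absI => [|l] absI.
  (* For [n = 0] the given walk has no edge, so it is lengthened first. *)
  have [b Rab _] := extend _ n.+1 _ _ (leqnn n) (leqnSn n) walk_ab.
  by exists b; rewrite -{1}(absorbs_inv_diag_edge hA absI Rab).
have [||c closed] := closed_walk absI (a := w ord0) (b := w ord_max).
- exact: (extend n).
- by apply: (extend n) => //; lia.
have {closed} : relpow R (2 ^ (l.+1 * (n.+1 * n.+1))) (c, c).
  apply: extend closed; first lia.
  exact/ltnW/ltn_expl.
elim: (l.+1 * _) c => [|j IHj] c; first by move/relpow1; exists c.
rewrite expnSr => /relpow_mul /relpowS [b /relpow1 Qcb Qbc].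
have [d] := edge_sym_loop hA ord0 (subuniverse_relpow hR (k := 2 ^ j))
  (absorbs_diag_relpow (2 ^ j) absR) Qcb Qbc.
exact: IHj.
Qed.
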